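(* Let $(M,H)$ be a Hamilton space with Hamiltonian vector field $\rho_H$ and adapted tangent structure $\mathcal{J}_H$. Let $\mathcal{N}$ be an arbitrary nonlinear connection on $T^{*}M\setminus\{0\}$ with projectors $h,v$, and let $\nabla$ be the dynamical covariant derivative induced by $\rho_H$ and $\mathcal{N}$. Then a vector field $X\in\mathcal{X}(T^{*}M\setminus\{0\})$ is a Newtonoid vector field if and only if $$v(X)=\mathcal{J}_H(\nabla X).$$
   Context: Hamilton space: $M$ is a smooth $n$-dimensional manifold and $H:T^{*}M\to\mathbb{R}$ is smooth on $T^{*}M\setminus\{0\}$ (zero section removed), continuous on the zero section, with $g^{ij}=\frac{\partial^2H}{\partial p_i\partial p_j}$ of rank $n$ and constant signature on $T^{*}M\setminus\{0\}$, in induced coordinates $(x^i,p_i)$; $(g_{ij})$ is the inverse matrix. All structures are considered on $T^{*}M\setminus\{0\}$. Adapted tangent structure: $\mathcal{J}_H=g_{ij}\,dx^i\otimes\frac{\partial}{\partial p_j}$, i.e. $\mathcal{J}_H(\partial/\partial x^i)=g_{ij}\,\partial/\partial p_j$, $\mathcal{J}_H(\partial/\partial p_i)=0$. Hamiltonian vector field: $\rho_H=\frac{\partial H}{\partial p_i}\frac{\partial}{\partial x^i}-\frac{\partial H}{\partial x^i}\frac{\partial}{\partial p_i}$, the vector field with $i_{\rho_H}\omega=-dH$, where $\omega=dp_i\wedge dx^i$. Nonlinear connection: a $(1,1)$-tensor field $\mathcal{N}$ with $\mathcal{N}^2=\mathrm{Id}$ and $\ker(\mathrm{Id}+\mathcal{N})$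 equal to the vertical distribution spanned by $\partial/\partial p_i$; $h=\frac12(\mathrm{Id}+\mathcal{N})$, $v=\frac12(\mathrm{Id}-\mathcal{N})$. Dynamical covariant derivative on vector fields: $\nabla X=h[\rho_H,hX]+v[\rho_H,vX]$. Newtonoid vector field: a vector field $X$ with $\mathcal{J}_H[\rho_H,X]=0$. *)

(* Defs.v *)
From HB Require Import structures.
From mathcomp Require Export all_boot all_order all_algebra.
From mathcomp Require Export all_classical all_reals all_analysis.
Export Order.TTheory GRing.Theory Num.Theory.
Export numFieldNormedType.Exports.

Set Implicit Arguments.
Unset Strict Implicit.
Unset Printing Implicit Defensive.

Local Open Scope classical_set_scope.
Local Open Scope ring_scope.

Section LocalExpressions.
Context {R : realType}.

(* C^oo on an open set A: every iterated directional derivative of f, f itself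
   included, is Frechet differentiable at every point of A. *)
Definition smooth_on {V W : normedModType R} (A : set V) (f : V -> W) : Prop :=
  forall (vs : seq V) (x : V), A x ->
    differentiable (foldr (fun v (g : V -> W) => 'D_v g) f vs) x.

(* f o phi^-1, for coordinates phi that are injective on D; the value is the
   dummy 0 off phi(D). *)
Definition local_expr {S : Type} {V W : normedModType R}
    (D : set S) (phi : S -> V) (f : S -> W) : V -> W :=
  fun y => xget 0 (f @` (D `&` phi @^-1` [set y])).

End LocalExpressions.

(* A smooth n-manifold: a Hausdorff second countable space with a smooth atlas.
   mfd_homeo says that each chart is a homeomorphism from its open domain onto
   an open subset of R^n (take A = dom c for the openness of the image). *)
Record manifold (R : realType) (n : nat) := Manifold {
  mfd_pt :> topologicalType;
  chart : Type;
  dom : chart -> set mfd_pt;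
  crd : chart -> mfd_pt -> 'rV[R]_n;
  mfd_hausdorff : hausdorff_space mfd_pt;
  mfd_second_countable : @second_countable mfd_pt;
  mfd_cover : forall x : mfd_pt, exists c, dom c x;
  mfd_dom_open : forall c, open (dom c);
  mfd_crd_inj : forall c x y, dom c x -> dom c y -> crd c x = crd c y -> x = y;
  mfd_homeo : forall c (A : set mfd_pt), A `<=` dom c ->
    (open A <-> open (crd c @` A));
  mfd_compat : forall c d,
    smooth_on (crd c @` (dom c `&` dom d))
              (local_expr (dom c) (crd c) (crd d))
}.

Section Cotangent.
Context {R : realType} {n : nat} (M : manifold R n).

Definition transition (c d : chart M) : 'rV[R]_n -> 'rV[R]_n :=
  local_expr (dom c) (crd c) (crd d).

(* A covector at a point x is the family (p_i) of its components in all the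
   charts around x, subject to p_i = p'_j dx'^j/dx^i.  The components in the
   charts whose domain does not contain x carry no information and are set to 0,
   so that equality of covectors is Leibniz equality. *)
Record cotangent := Cotangent {
  base : M;
  mom : chart M -> 'rV[R]_n;
  mom_compat : forall c d, dom c base -> dom d base -> forall i,
    mom c 0 i = \sum_(j < n) mom d 0 j
      * ('D_(delta_mx 0 i) (transition c d) (crd c base)) 0 j;
  mom_off : forall c, ~ dom c base -> mom c = 0
}.

Definition nonzero (u : cotangent) : Prop := exists c, mom u c <> 0.

(* T^*M with the zero section removed. *)
Definition slit := {u : cotangent | nonzero u}.

(* Values of the induced coordinates (x^i, p_i), and components of tangent
   vectors: (a, b) stands for a^i d/dx^i + b_i d/dp_i. *)
Definition model : normedModType R := ('rV[R]_n * 'rV[R]_n)%type.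

Definition over (c : chart M) : set cotangent := [set u | dom c (base u)].

Definition ccrd (c : chart M) (u : cotangent) : model :=
  (crd c (base u), mom u c).

Definition over0 (c : chart M) : set slit := [set u | over c (sval u)].

Definition ccrd0 (c : chart M) (u : slit) : model := ccrd c (sval u).

Definition local0 {W : normedModType R} (c : chart M) (f : slit -> W) :
  model -> W := local_expr (over0 c) (ccrd0 c) f.

Definition ddx (i : 'I_n) : model := (delta_mx 0 i, 0).
Definition ddp (i : 'I_n) : model := (0, delta_mx 0 i).

(* Tensor fields on T^*M \ {0} are given by their components in the induced
   charts; values at (u, c) with u outside the domain of c are irrelevant. *)
Definition field := slit -> chart M -> model.
Definition endo_field := slit -> chart M -> {linear model -> model}.

Definition push (c d : chart M) (u : slit) (e : model) : model :=
  'D_e (local0 c (ccrd0 d)) (ccrd0 c u).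

Definition vector_field (X : field) : Prop :=
  (forall c, smooth_on (ccrd0 c @` over0 c) (local0 c (X^~ c))) /\
  (forall c d u, over0 c u -> over0 d u -> X u d = push c d u (X u c)).

Definition tensor11 (N : endo_field) : Prop :=
  (forall c e, smooth_on (ccrd0 c @` over0 c) (local0 c (fun u => N u c e))) /\
  (forall c d u, over0 c u -> over0 d u ->
     forall e, N u d (push c d u e) = push c d u (N u c e)).

Definition field_eq (X Y : field) : Prop :=
  forall u c, over0 c u -> X u c = Y u c.

Definition zero_field : field := fun _ _ => 0.

Definition lie_bracket (X Y : field) : field := fun u c =>
  'D_(X u c) (local0 c (Y^~ c)) (ccrd0 c u)
  - 'D_(Y u c) (local0 c (X^~ c)) (ccrd0 c u).

Definition vertical (e : model) : Prop :=
  exists b : 'I_n -> R, e = \sum_(i < n) b i *: ddp i.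

Definition nonlinear_connection (N : endo_field) : Prop :=
  [/\ tensor11 N,
      forall u c, over0 c u -> forall e, N u c (N u c e) = e
    & forall u c, over0 c u -> forall e, e + N u c e = 0 <-> vertical e].

Definition hproj (N : endo_field) (X : field) : field :=
  fun u c => 2^-1 *: (X u c + N u c (X u c)).
Definition vproj (N : endo_field) (X : field) : field :=
  fun u c => 2^-1 *: (X u c - N u c (X u c)).

(* A has k positive, l negative and n - k - l zero diagonal entries after
   diagonalization by congruence. *)
Definition has_signature (A : 'M[R]_n) (k l : nat) : Prop :=
  (k + l <= n)%N /\
  exists2 P : 'M[R]_n, P \in unitmx &
    P *m A *m P^T = diag_mx (\row_(i < n)
      (if (i < k)%N then 1 else if (i < k + l)%N then -1 else 0)).

Section Hamiltonian.
Variable H : cotangent -> R.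

Definition localH (c : chart M) : model -> R :=
  local_expr (over c) (ccrd c) H.

(* g^{ij} *)
Definition gup (u : slit) (c : chart M) : 'M[R]_n :=
  \matrix_(i, j) 'D_(ddp i) ('D_(ddp j) (localH c)) (ccrd0 c u).

(* g_{ij} *)
Definition gdown (u : slit) (c : chart M) : 'M[R]_n := invmx (gup u c).

Definition hamilton_space : Prop :=
  [/\ forall c, smooth_on (ccrd0 c @` over0 c) (localH c),
      forall c u, over c u -> ~ nonzero u ->
        {for ccrd c u, continuous (localH c)},
      forall u c, over0 c u -> \rank (gup u c) = n
    & exists k l, forall u c, over0 c u -> has_signature (gup u c) k l].

Definition hamiltonian_vf : field := fun u c =>
  \sum_(i < n) ('D_(ddp i) (localH c) (ccrd0 c u) *: ddx i
                - 'D_(ddx i) (localH c) (ccrd0 c u) *: ddp i).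

(* J_H (a^i d/dx^i + b_i d/dp_i) = a^i g_{ij} d/dp_j *)
Definition tangent_structure (X : field) : field := fun u c =>
  \sum_(j < n) (\sum_(i < n) (X u c).1 0 i * gdown u c i j) *: ddp j.

Definition dyn_cov_derivative (N : endo_field) (X : field) : field := fun u c =>
  hproj N (lie_bracket hamiltonian_vf (hproj N X)) u c
  + vproj N (lie_bracket hamiltonian_vf (vproj N X)) u c.

Definition newtonoid (X : field) : Prop :=
  field_eq (tangent_structure (lie_bracket hamiltonian_vf X)) zero_field.

End Hamiltonian.

End Cotangent.

(* Main.v *)
From HB Require Import structures.
Require Import Defs.

(** Write [rho] for the Hamiltonian field and [J] for the tangent structure.
    Everything happens pointwise, in one induced chart, where [J] sees only the
    horizontal (dx) components of a vector and has vertical values.  Splitting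
    [X = hX + vX] gives [J [rho, X] = J [rho, hX] + J [rho, vX]], and the two
    summands are computed separately.

    - [J] kills vertical vectors, hence [J v = 0] and [J h = J]; applied to the
      definition of the dynamical covariant derivative this yields
      [J (nabla X) = J [rho, hX]].
    - If [Y = b_j d/dp_j] is vertical, the dx^i component of [[rho, Y]] is
      [- b_j d^2 H/dp_j dp_i = - b_j g^{ji}] (lemma [lie_bracket_vertical]);
      contracting with [g_{ik}] returns [- b_k], that is [J [rho, Y] = - Y].

    Together [J [rho, X] = J (nabla X) - vX] ([tangent_structure_lie]), so one
    side vanishes exactly when [vX = J (nabla X)].

    Two analytic points need work, since brackets are taken on local
    expressions that are extended by the dummy 0 off the image of a chart.
    First, the derivative of [rho] in a chart can only be computed from its
    formula in terms of [H] if the image of the induced chart is open in the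
    model space ([open_over0]); this in turn requires that every tuple of
    momenta in a chart comes from a covector ([cotangent_exists]), which is the
    cocycle rule for the derivatives of the transition maps.  Secondly, [hX] and
    [vX] must have differentiable local expressions, although the smoothness of
    [N] is known only for its values on constant model vectors; expanding [X] in
    the coordinate basis takes care of this ([endo_field_differentiable]). *)

Set Implicit Arguments.
Unset Strict Implicit.
Unset Printing Implicit Defensive.

Local Open Scope classical_set_scope.
Local Open Scope ring_scope.

(** * Local expressions in a chart *)

Section LocalExpr.
Context {R : realType} {S : Type} {V W : normedModType R}.
Variables (D : set S) (phi : S -> V).

Lemma local_expr_off (f : S -> W) y :
  ~ (phi @` D) y -> local_expr D phi f y = 0.
Proof.
by move=> ny; apply: xgetPN => w [s [Ds /= sy] _]; apply: ny; exists s.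
Qed.

Hypothesis phi_inj : forall s t, D s -> D t -> phi s = phi t -> s = t.

Lemma local_expr_at (f : S -> W) s :
  D s -> local_expr D phi f (phi s) = f s.
Proof.
move=> Ds; apply: xget_unique; first by exists s.
by move=> _ [t [Dt /= ts] <-]; congr f; exact: phi_inj.
Qed.

End LocalExpr.

(** * Directional derivatives *)

Section Calculus.
Context {R : realType}.

Lemma derive_suml {V W : normedModType R} (f : V -> W) (x : V) m
    (a : 'I_m -> R) (v : 'I_m -> V) : differentiable f x ->
  'D_(\sum_(i < m) a i *: v i) f x = \sum_(i < m) a i *: 'D_(v i) f x.
Proof.
move=> df; rewrite deriveE // linear_sum /=.
by apply: eq_bigr => i _; rewrite linearZ /= deriveE.
Qed.

Lemma derive_addl {V W : normedModType R} (f : V -> W) (x v w : V) :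
  differentiable f x -> 'D_(v + w) f x = 'D_v f x + 'D_w f x.
Proof. by move=> df; rewrite !deriveE // linearD. Qed.

Lemma derive_linear_comp {V W Z : normedModType R} (l : {linear W -> Z})
    (f : V -> W) (x v : V) : continuous l -> differentiable f x ->
  'D_v (l \o f) x = l ('D_v f x).
Proof.
move=> lc df; have dl := @linear_differentiable _ _ _ l (f x) lc.
rewrite deriveE; last exact: differentiable_comp.
by rewrite diff_comp //= diff_lin // deriveE.
Qed.

Lemma derive_comp {V W Z : normedModType R} (f : V -> W) (g : W -> Z)
    (x v : V) : differentiable f x -> differentiable g (f x) ->
  'D_v (g \o f) x = 'D_('D_v f x) g (f x).
Proof.
move=> df dg; rewrite deriveE; last exact: differentiable_comp.
by rewrite diff_comp //= !deriveE.
Qed.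

Lemma scaler_is_bilinear (V : normedModType R) :
  bilinear_for (GRing.Scale.Law.clone _ _ *:%R _)
    (GRing.Scale.Law.clone _ _ *:%R _) ( *:%R : R^o -> V -> V).
Proof.
split=> [u a x y|u a x y] /=.
  by rewrite scalerDl scalerA.
by rewrite scalerDr !scalerA mulrC.
Qed.

Lemma differentiable_scale {V W : normedModType R} (k : V -> R^o) (f : V -> W)
    (x : V) : differentiable k x -> differentiable f x ->
  differentiable (fun y => k y *: f y) x.
Proof.
move=> dk df.
pose bM := bilinear_isBilinear.Build _ _ _ _ _ _ _ (@scaler_is_bilinear W).
pose b : {bilinear R^o -> W -> W} := HB.pack ( *:%R : R^o -> W -> W) bM.
have db : differentiable (fun q : R^o * W => b q.1 q.2) (k x, f x).
  by apply: differentiable_bilin; exact: scale_continuous.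
exact: (@differentiable_comp _ _ _ _ (fun y => (k y, f y)) _ x
          (differentiable_pair dk df) db).
Qed.


End Calculus.

(** * Covectors and the image of an induced chart *)

Section Covectors.
Context {R : realType} {n : nat} (M : manifold R n).
Implicit Types (c d e : chart M) (x : M) (p : 'rV[R]_n).

Lemma transition_crd c d x : dom c x -> transition c d (crd c x) = crd d x.
Proof. by move=> cx; apply: local_expr_at => //; exact: mfd_crd_inj. Qed.

Lemma near_overlap c d x : dom c x -> dom d x ->
  \forall y \near crd c x, (crd c @` (dom c `&` dom d)) y.
Proof.
move=> cx dx; apply: open_nbhs_nbhs; split; last by exists x.
by apply/(@mfd_homeo _ _ M c) => [y []//|]; apply: openI; exact: mfd_dom_open.
Qed.

Lemma transition_differentiable c d x : dom c x -> dom d x ->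
  differentiable (transition c d) (crd c x).
Proof. by move=> cx dx; apply: (@mfd_compat _ _ M c d [::]); exists x. Qed.

Lemma transition_id_derive c x (v : 'rV[R]_n) : dom c x ->
  'D_v (transition c c) (crd c x) = v.
Proof.
move=> cx; rewrite -[RHS](derive_id (crd c x)); apply: near_eq_derive.
near=> y; have [z [cz _] <-] : (crd c @` (dom c `&` dom c)) y.
  by near: y; exact: near_overlap.
exact: transition_crd.
Unshelve. all: by end_near. Qed.

(** The chain rule for [d -> e -> c], which agrees with [d -> c] only on the
    overlap of [d] and [e]; its image is open, so derivatives coincide. *)
Lemma transition_cocycle_derive c d e x (v : 'rV[R]_n) :
  dom c x -> dom d x -> dom e x ->
  'D_v (transition d c) (crd d x) =
  'D_('D_v (transition d e) (crd d x)) (transition e c) (crd e x).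
Proof.
move=> cx dx ex; rewrite -[crd e x in RHS](@transition_crd d e) //.
rewrite -derive_comp; last 2 first.
- exact: transition_differentiable.
- by rewrite transition_crd //; exact: transition_differentiable.
apply: near_eq_derive; near=> y.
have [z [dz ez] <-] : (crd d @` (dom d `&` dom e)) y.
  by near: y; exact: near_overlap.
by rewrite /comp !transition_crd.
Unshelve. all: by end_near. Qed.

(** The components in the chart [d] of the covector [p_j dx^j] at [x], where the
    [x^j] are the coordinates of [c]. *)
Definition pull_mom c x p d : 'rV[R]_n :=
  if pselect (dom d x) is left _ then
    \row_i \sum_(j < n) p 0 j
      * ('D_(delta_mx 0 i) (transition d c) (crd d x)) 0 j
  else 0.

Lemma pull_mom_compat c x p : dom c x -> forall d e, dom d x -> dom e x ->
  forall i, pull_mom c x p d 0 i = \sum_(j < n) pull_mom c x p e 0 j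
      * ('D_(delta_mx 0 i) (transition d e) (crd d x)) 0 j.
Proof.
move=> cx d e dx ex i; rewrite /pull_mom.
case: pselect => // _; case: pselect => // _.
under [RHS]eq_bigr do rewrite mxE mulr_suml.
rewrite mxE exchange_big /=; apply: eq_bigr => k _.
rewrite (transition_cocycle_derive _ cx dx ex).
rewrite [X in 'D_X _ _]row_sum_delta derive_suml; last first.
  exact: transition_differentiable.
rewrite summxE mulr_sumr; apply: eq_bigr => j _.
by rewrite mxE -mulrA [X in _ * X = _]mulrC.
Qed.

Lemma pull_mom_off c x p d : ~ dom d x -> pull_mom c x p d = 0.
Proof. by move=> dx; rewrite /pull_mom; case: pselect. Qed.

Lemma pull_mom_id c x p : dom c x -> pull_mom c x p c = p.
Proof.
move=> cx; rewrite /pull_mom; case: pselect => // _; apply/rowP => i.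
rewrite mxE (bigD1 i) //= big1 => [|j ji].
  by rewrite transition_id_derive // mxE !eqxx mulr1 addr0.
by rewrite transition_id_derive // mxE (negbTE ji) andbF mulr0.
Qed.

Lemma cotangent_exists c x p : dom c x ->
  exists u : cotangent M, base u = x /\ mom u c = p.
Proof.
move=> cx.
exists (Cotangent (pull_mom_compat p cx) (@pull_mom_off c x p)); split=> //=.
exact: pull_mom_id.
Qed.

(** The transformation rule recovers all the momenta from those in one chart
    around the base point; charts elsewhere carry the value 0. *)
Lemma mom_determined c (u v : cotangent M) : dom c (base u) ->
  base u = base v -> mom u c = mom v c -> mom u = mom v.
Proof.
move=> cu uv mc; apply/funext => d.
have [du|du] := pselect (dom d (base u)); last first.
  by rewrite !mom_off // -uv.
apply/rowP => i; rewrite (mom_compat du cu).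
by rewrite (@mom_compat _ _ _ v d c) -?uv // mc.
Qed.

Lemma ccrd_inj c (u v : cotangent M) : over c u -> over c v ->
  ccrd c u = ccrd c v -> u = v.
Proof.
move=> cu cv [xuv muv].
have uv : base u = base v by exact: mfd_crd_inj xuv.
have := mom_determined cu uv muv.
case: u v uv {cu cv xuv muv} => [x m k l] [y m' k' l'] /= xy mm.
subst y m'; congr Cotangent; exact: Prop_irrelevance.
Qed.

Lemma ccrd0_inj c (u v : slit M) : over0 c u -> over0 c v ->
  ccrd0 c u = ccrd0 c v -> u = v.
Proof.
case: u v => [u pu] [v pv] cu cv /(ccrd_inj cu cv) /= uv.
by subst v; congr exist; exact: Prop_irrelevance.
Qed.

(** The momenta in [c] range over all nonzero vectors: each is realized by a
    covector, and a covector with zero momentum in [c] lies in the zero section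
    by the transformation rule. *)
Lemma image_over0 c : ccrd0 c @` over0 c =
  [set y : model | (crd c @` dom c) y.1 /\ y.2 != 0].
Proof.
apply/seteqP; split=> [_ [u cu <-]|[_ p] [/= [x cx <-] p0]].
  split; first by exists (base (sval u)).
  have [d ud] := svalP u; apply/eqP => /= uc0; apply: ud.
  have [du|/mom_off //] := pselect (dom d (base (sval u))).
  apply/rowP => i; rewrite (mom_compat du cu) mxE.
  by rewrite big1 // => j _; rewrite uc0 mxE mul0r.
have [u [ux up]] := cotangent_exists p cx.
have nzu : nonzero u by exists c; rewrite up; exact/eqP.
exists (exist _ u nzu); first by rewrite /over0 /over /= ux.
by rewrite /ccrd0 /ccrd /= ux up.
Qed.

Lemma open_over0 c : open (ccrd0 c @` over0 c).
Proof.
rewrite image_over0.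
have -> : [set y : @model R n | (crd c @` dom c) y.1 /\ y.2 != 0] =
    (fst @^-1` (crd c @` dom c)) `&` (snd @^-1` (~` [set 0])).
  by apply/seteqP; split=> y [? /eqP ?]; split.
apply: openI.
  apply: open_comp => [y _|]; first exact: cvg_fst.
  by apply/(@mfd_homeo _ _ M c) => //; exact: mfd_dom_open.
apply: open_comp => [y _|]; first exact: cvg_snd.
by apply: closed_openC; exact/accessible_closed_set1/hausdorff_accessible/norm_hausdorff.
Qed.

End Covectors.

(** * Fields and the projectors of a nonlinear connection *)

Section LocalFields.
Context {R : realType} {n : nat} (M : manifold R n).
Implicit Types (c : chart M) (u : slit M) (X Y : field M) (N : endo_field M).

Lemma local0_at (W : normedModType R) c (f : slit M -> W) u :
  over0 c u -> local0 c f (ccrd0 c u) = f u.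
Proof. by move=> cu; apply: local_expr_at => //; exact: ccrd0_inj. Qed.

(** An identity between local expressions holds on the whole model space as soon
    as it holds on the chart and the right-hand side takes the dummy value 0
    elsewhere; so no restriction to a neighbourhood is needed for operations
    that preserve 0. *)
Lemma local0_lift (W : normedModType R) c (f : slit M -> W) (F : model -> W) :
  (forall u, over0 c u -> f u = F (ccrd0 c u)) ->
  (forall y, ~ (ccrd0 c @` over0 c) y -> F y = 0) -> local0 c f = F.
Proof.
move=> on off; apply/funext => y.
have [[u cu <-]|ny] := pselect ((ccrd0 c @` over0 c) y).
  by rewrite local0_at // on.
by rewrite off // /local0 local_expr_off.
Qed.

Lemma local0_comb c (f g : slit M -> @model R n) (a b : R) :
  local0 c (fun w => a *: f w + b *: g w) =
  (fun y => a *: local0 c f y + b *: local0 c g y).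
Proof.
apply: local0_lift => [u cu|y ny]; first by rewrite !local0_at.
by rewrite /local0 !local_expr_off // !scaler0 addr0.
Qed.

Lemma model_basis (e : @model R n) :
  e = \sum_(i < n) e.1 0 i *: ddx i + \sum_(i < n) e.2 0 i *: ddp i.
Proof.
case: e => a b /=.
have -> : \sum_(i < n) a 0 i *: @ddx R n i = (a, 0).
  rewrite [in RHS](row_sum_delta a).
  elim/big_ind2 : _ => // [x _ y _ -> ->|i _]; first by congr pair; rewrite addr0.
  by congr pair; rewrite scaler0.
have -> : \sum_(i < n) b 0 i *: @ddp R n i = (0, b).
  rewrite [in RHS](row_sum_delta b).
  elim/big_ind2 : _ => // [x _ y _ -> ->|i _]; first by congr pair; rewrite addr0.
  by congr pair; rewrite scaler0.
by congr pair; rewrite ?addr0 ?add0r.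
Qed.

Definition hcoord (i : 'I_n) (e : @model R n) : R^o := e.1 0 i.

Lemma hcoord_is_linear i : linear (hcoord i).
Proof. by move=> a e f; rewrite /hcoord !mxE. Qed.

HB.instance Definition _ i :=
  GRing.isLinear.Build R (@model R n) R^o *:%R (hcoord i) (hcoord_is_linear i).

Definition vcoord (i : 'I_n) (e : @model R n) : R^o := e.2 0 i.

Lemma vcoord_is_linear i : linear (vcoord i).
Proof. by move=> a e f; rewrite /vcoord !mxE. Qed.

HB.instance Definition _ i :=
  GRing.isLinear.Build R (@model R n) R^o *:%R (vcoord i) (vcoord_is_linear i).

Lemma hcoord_continuous i : continuous (hcoord i).
Proof.
move=> e; apply: (@continuous_comp _ _ _ fst (fun a : 'rV[R]_n => a 0 i)).
  exact: cvg_fst.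
exact: coord_continuous.
Qed.

Lemma vcoord_continuous i : continuous (vcoord i).
Proof.
move=> e; apply: (@continuous_comp _ _ _ snd (fun a : 'rV[R]_n => a 0 i)).
  exact: cvg_snd.
exact: coord_continuous.
Qed.

Lemma vector_field_differentiable c u X : vector_field X -> over0 c u ->
  differentiable (local0 c (X^~ c)) (ccrd0 c u).
Proof. by move=> [sX _] cu; apply: (sX c [::]); exists u. Qed.

(** [N X] is the combination of the fields [N (d/dx^i)] and [N (d/dp_i)], smooth
    by assumption on [N], with the components of [X] as coefficients. *)
Lemma endo_field_differentiable c u X N : tensor11 N -> vector_field X ->
  over0 c u ->
  differentiable (local0 c (fun w => N w c (X w c))) (ccrd0 c u).
Proof.
move=> [sN _] vX cu.
have dX := vector_field_differentiable vX cu.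
have dN e : differentiable (local0 c (fun w => N w c e)) (ccrd0 c u).
  by apply: (sN c e [::]); exists u.
rewrite (@local0_lift _ c _ (fun y =>
    (\sum_(i < n) (fun y => hcoord i (local0 c (X^~ c) y)
                      *: local0 c (fun w => N w c (ddx i)) y)) y
  + (\sum_(i < n) (fun y => vcoord i (local0 c (X^~ c) y)
                      *: local0 c (fun w => N w c (ddp i)) y)) y)).
- apply: differentiableD; apply: differentiable_sum => i;
    apply: differentiable_scale => //;
    apply: (differentiable_comp dX); apply: linear_differentiable.
    exact: hcoord_continuous.
  exact: vcoord_continuous.
- move=> w cw; rewrite !fct_sumE {1}[X w c]model_basis linearD !linear_sum /=.
  by congr (_ + _); apply: eq_bigr => i _; rewrite !local0_at // linearZ.
move=> y ny; rewrite !fct_sumE !big1 ?addr0 // => i _;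
  by rewrite /local0 !local_expr_off // scaler0.
Qed.

Lemma endo_comb_differentiable c u X N (a b : R) : tensor11 N ->
  vector_field X -> over0 c u ->
  differentiable (local0 c (fun w => a *: X w c + b *: N w c (X w c)))
    (ccrd0 c u).
Proof.
move=> tN vX cu; rewrite local0_comb.
apply: differentiableD; apply: differentiableZ.
  exact: vector_field_differentiable.
exact: endo_field_differentiable.
Qed.

Lemma hproj_differentiable c u X N : tensor11 N -> vector_field X ->
  over0 c u -> differentiable (local0 c ((hproj N X)^~ c)) (ccrd0 c u).
Proof.
move=> tN vX cu; under eq_fun do rewrite /hproj scalerDr.
exact: endo_comb_differentiable.
Qed.

Lemma vproj_differentiable c u X N : tensor11 N -> vector_field X ->
  over0 c u -> differentiable (local0 c ((vproj N X)^~ c)) (ccrd0 c u).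
Proof.
move=> tN vX cu; under eq_fun do rewrite /vproj scalerBr -scaleNr.
exact: endo_comb_differentiable.
Qed.

Lemma hproj_add_vproj N X u c : X u c = hproj N X u c + vproj N X u c.
Proof.
rewrite /hproj /vproj -scalerDr addrACA subrr addr0 scalerDr -scalerDl.
by rewrite -div1r -splitr scale1r.
Qed.

(** [N^2 = Id] makes [vX = (X - NX) / 2] an eigenvector of [N] for -1, and these
    are the vertical vectors. *)
Lemma vproj_fst N X u c : nonlinear_connection N -> over0 c u ->
  (vproj N X u c).1 = 0.
Proof.
move=> [_ invN vertN] cu.
have : vproj N X u c + N u c (vproj N X u c) = 0.
  rewrite /vproj [N u c (_ *: _)]linearZ /= [N u c (_ - _)]linearB invN // -scalerDr.
  by rewrite subrKA subrr scaler0.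
move=> /(vertN u c cu)[b ->].
elim/big_ind : _ => // [x y x0 y0|i _]; first by rewrite /= x0 y0 addr0.
exact: scaler0.
Qed.

Lemma hproj_fst N X u c : nonlinear_connection N -> over0 c u ->
  (hproj N X u c).1 = (X u c).1.
Proof.
move=> cN cu; rewrite [X u c in RHS](hproj_add_vproj N X).
by rewrite -[RHS]/((hproj N X u c).1 + (vproj N X u c).1) vproj_fst // addr0.
Qed.

End LocalFields.

(** * Brackets with the Hamiltonian field *)

Section Newtonoid.
Context {R : realType} {n : nat} (M : manifold R n) (H : cotangent M -> R).
Hypothesis hH : hamilton_space H.
Implicit Types (c : chart M) (u : slit M) (X Y : field M) (N : endo_field M).

(** The coordinate formula for the Hamiltonian field, as a function on the whole
    model space.  The local expression of the field agrees with it only on the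
    image of the chart, off which this formula need not vanish. *)
Definition Hflow c (y : @model R n) : @model R n :=
  \sum_(i < n) ('D_(ddp i) (localH H c) y *: ddx i
                - 'D_(ddx i) (localH H c) y *: ddp i).

Lemma Hflow_near c u : over0 c u ->
  \forall y \near ccrd0 c u, local0 c ((hamiltonian_vf H)^~ c) y = Hflow c y.
Proof.
move=> cu; near=> y; have [w cw <-] : (ccrd0 c @` over0 c) y.
  near: y; apply: open_nbhs_nbhs; split; first exact: open_over0.
  by exists u.
by rewrite local0_at.
Unshelve. all: by end_near. Qed.

Lemma Hflow_differentiable c u : over0 c u ->
  differentiable (Hflow c) (ccrd0 c u).
Proof.
move=> cu; have [sH _ _ _] := hH.
have dH e : differentiable ('D_e (localH H c) : _ -> R^o) (ccrd0 c u).
  by apply: (sH c [:: e]); exists u.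
rewrite (_ : Hflow c = \sum_(i < n) (fun y =>
    'D_(ddp i) (localH H c) y *: ddx i - 'D_(ddx i) (localH H c) y *: ddp i)).
  apply: differentiable_sum => i.
  by apply: differentiableB; exact: differentiableZl.
by apply/funext => y; rewrite fct_sumE.
Qed.

Lemma hcoord_Hflow c i :
  hcoord i \o Hflow c = 'D_(ddp i) (localH H c) :> (_ -> R^o).
Proof.
have coordE (a b : R) j :
    hcoord i (a *: ddx j - b *: ddp j) = a * (i == j)%:R.
  by rewrite /hcoord /= !mxE mulr0 subr0.
apply/funext => y; rewrite /comp linear_sum (bigD1 i) //= big1 => [|j ji].
  by rewrite coordE eqxx mulr1 addr0.
by rewrite coordE eq_sym (negbTE ji) mulr0.
Qed.

Lemma lie_bracketE c u Y : over0 c u ->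
  lie_bracket (hamiltonian_vf H) Y u c =
  'D_(hamiltonian_vf H u c) (local0 c (Y^~ c)) (ccrd0 c u)
  - 'D_(Y u c) (Hflow c) (ccrd0 c u).
Proof.
by move=> cu; rewrite /lie_bracket (near_eq_derive _ (Hflow_near cu)).
Qed.

Lemma lie_bracketD c u X Y Z : over0 c u ->
  (forall w d, X w d = Y w d + Z w d) ->
  differentiable (local0 c (Y^~ c)) (ccrd0 c u) ->
  differentiable (local0 c (Z^~ c)) (ccrd0 c u) ->
  lie_bracket (hamiltonian_vf H) X u c =
  lie_bracket (hamiltonian_vf H) Y u c + lie_bracket (hamiltonian_vf H) Z u c.
Proof.
move=> cu XYZ dY dZ; rewrite !lie_bracketE //.
have -> : X^~ c = fun w => 1 *: Y w c + 1 *: Z w c.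
  by apply/funext => w; rewrite !scale1r XYZ.
rewrite local0_comb XYZ derive_addl; last exact: Hflow_differentiable.
under eq_fun do rewrite !scale1r.
by rewrite deriveD; [rewrite opprD addrACA|exact: diff_derivable..].
Qed.

(** The component along [rho] differentiates the constant function 0; the other
    one differentiates [dH/dp_i] in the direction [Y], which brings in the
    Hessian of [H] with respect to the momenta. *)
Lemma lie_bracket_vertical c u Y : over0 c u ->
  (forall w, over0 c w -> (Y w c).1 = 0) ->
  differentiable (local0 c (Y^~ c)) (ccrd0 c u) ->
  (lie_bracket (hamiltonian_vf H) Y u c).1 = - ((Y u c).2 *m gup H u c).
Proof.
move=> cu Y0 dY; rewrite lie_bracketE //; apply/rowP => i.
have fst_rho : hcoord i ('D_(hamiltonian_vf H u c) (local0 c (Y^~ c))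
    (ccrd0 c u)) = 0.
  rewrite -derive_linear_comp //; last exact: hcoord_continuous.
  rewrite (_ : _ \o _ = cst 0) ?derive_cst //; apply/funext => y /=.
  have [[w cw <-]|ny] := pselect ((ccrd0 c @` over0 c) y).
    by rewrite local0_at // /hcoord Y0 // mxE.
  by rewrite /local0 local_expr_off // linear0.
have fst_Y : hcoord i ('D_(Y u c) (Hflow c) (ccrd0 c u)) =
    ((Y u c).2 *m gup H u c) 0 i.
  have Ydec : Y u c = \sum_(j < n) (Y u c).2 0 j *: ddp j.
    rewrite [LHS]model_basis (Y0 u cu) big1 ?add0r => [//|j _].
    by rewrite mxE scale0r.
  rewrite [X in 'D_X _ _]Ydec derive_suml; last exact: Hflow_differentiable.
  rewrite linear_sum mxE; apply: eq_bigr => j _; rewrite linearZ /=.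
  rewrite -derive_linear_comp; last exact: Hflow_differentiable.
    by rewrite hcoord_Hflow mxE.
  exact: hcoord_continuous.
move: ('D_(_) (local0 _ _) _) ('D_(_) (Hflow c) _) fst_rho fst_Y => A B A0 BM.
by rewrite [RHS]mxE -BM -[LHS]/(hcoord i (A - B)) linearB /= A0 sub0r.
Qed.

Lemma tangent_structureE X u c :
  tangent_structure H X u c = (0, (X u c).1 *m gdown H u c).
Proof.
rewrite [RHS]model_basis /= big1 ?add0r => [|i _]; last by rewrite mxE scale0r.
by apply: eq_bigr => j _; rewrite mxE.
Qed.

Lemma gup_gdown u c : over0 c u -> gup H u c *m gdown H u c = 1%:M.
Proof.
move=> cu; have [_ _ rkH _] := hH; apply: mulmxV.
by rewrite -row_free_unit /row_free rkH.
Qed.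

(** The identity [J [rho, X] = J (nabla X) - vX], valid for every vector field;
    both [J h = J] and [J [rho, vX] = - vX] enter here. *)
Lemma tangent_structure_lie N X u c : nonlinear_connection N ->
  vector_field X -> over0 c u ->
  tangent_structure H (lie_bracket (hamiltonian_vf H) X) u c =
  tangent_structure H (dyn_cov_derivative H N X) u c - vproj N X u c.
Proof.
move=> cN vX cu; have [tN _ _] := cN; rewrite !tangent_structureE.
have dv := vproj_differentiable tN vX cu.
rewrite (lie_bracketD cu (hproj_add_vproj N X)) //; last first.
  exact: hproj_differentiable.
have -> : (dyn_cov_derivative H N X u c).1 =
    (lie_bracket (hamiltonian_vf H) (hproj N X) u c).1.
  rewrite -[LHS]/((hproj N _ u c).1 + (vproj N _ u c).1).
  by rewrite hproj_fst // vproj_fst // addr0.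
rewrite /= mulmxDl [X in _ + X *m _]lie_bracket_vertical //; last first.
  by move=> w cw; exact: vproj_fst.
rewrite mulNmx -mulmxA gup_gdown // mulmx1.
rewrite [in RHS](surjective_pairing (vproj N X u c)) vproj_fst //.
by congr pair; rewrite subr0.
Qed.

End Newtonoid.

Theorem proposition2 (R : realType) (n : nat) (M : manifold R n)
    (H : cotangent M -> R) (hH : hamilton_space H)
    (N : endo_field M) (hN : nonlinear_connection N)
    (X : field M) (hX : vector_field X) :
  newtonoid H X <->
  field_eq (vproj N X) (tangent_structure H (dyn_cov_derivative H N X)).
Proof.
split=> eqX u c cu.
  by apply/esym/subr0_eq; rewrite -tangent_structure_lie //; exact: eqX.
by rewrite (tangent_structure_lie hH hN hX cu) -eqX // subrr.
Qed.
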